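(* For every $p\in[0,1]$ and every $\varepsilon>0$ there exists an instance $\mathcal{I}=(G,\{r_i,F_i\}_{i\in[N]})$ of the online matching problem with reusable resources, with $F_i=\mathrm{Geometric}(p_i)$ for all $i\in[N]$ and $\min_{i\in[N]}p_i=p$, such that $$\frac{\mathsf{Greedy}(\mathcal{I})}{\mathsf{OPT}(\mathcal{I})}\ \le\ \frac{1+p}{2}+\varepsilon.$$
   Context: Model. An instance $\mathcal{I}=(G,\{r_i,F_i\}_{i\in[N]})$ consists of a bipartite graph $G$ with $N$ offline vertices (''resources'', indexed by $[N]=\{1,\dots,N\}$) and $T$ online vertices (''requests'', indexed by $1,\dots,T$), rewards $0\le r_1\le\dots\le r_N$, and for each resource $i$ a probability distribution $F_i$ of usage durations, supported on $\{1,2,3,\dots\}\cup\{+\infty\}$ ($+\infty$ meaning the resource never returns). Let $N_t\subseteq[N]$ be the set of resources adjacent to request $t$. At each time $t=1,\dots,T$ request $t$ arrives, $N_t$ is revealed, and a policy irrevocably chooses $A_t\in(N_t\cap I_t)\cup\{0\}$, where $I_t\subseteq[N]$ is the set of resources available at time $t$ (all resources are available at time 1) and $0$ means no match. If $A_t=i\in[N]$, the policy earns reward $r_i$, and resource $i$ becomes unavailable for a random duration $D_{it}\ge1$ drawn from $F_i$, independently for every match; it becomes available again at the start of time $t+D_{it}$ and can be matched immediately. $\mathrm{Geometric}(q)$, for $q\in[0,1]$, is the distribution on $\{1,2,\dots\}$ with $\Pr(D=k)=(1-q)^{k-1}q$; for $q=0$ the duration is $+\infty$ almost surely. The greedy policy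 chooses $A_t=\max\big((N_t\cap I_t)\cup\{0\}\big)$, i.e. the available adjacent resource of highest index (hence highest reward). $\mathsf{Greedy}(\mathcal{I})$ is its expected total reward. $\mathsf{OPT}(\mathcal{I})$ is the expected total reward of an optimal clairvoyant policy: a policy of maximum expected total reward among all policies that know the whole instance $\mathcal{I}$ (in particular the entire graph $G$) in advance but do not know the realizations of the usage durations ahead of time (decisions at time $t$ depend only on what has been observed so far). The instance in the claim is understood to have $\mathsf{OPT}(\mathcal{I})>0$. *)

(* Defs.v *)
From HB Require Import structures.
From mathcomp Require Import all_boot all_order all_algebra.
From mathcomp Require Import all_classical all_reals all_analysis.
Set Implicit Arguments.
Unset Strict Implicit.
Unset Printing Implicit Defensive.
Import Order.TTheory GRing.Theory Num.Theory.
Local Open Scope classical_set_scope.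
Local Open Scope ring_scope.

(* Probability mass functions on {1, 2, ...} U {+oo}.  The duration k is
   [Some k] and +oo is [None]; [Some 0] is not a legal duration and therefore
   carries no mass. *)
Record usage_law (R : realType) := UsageLaw {
  pmf :> option nat -> R ;
  pmf_ge0 : forall x, 0 <= pmf x ;
  pmf_Some0 : pmf (Some 0%N) = 0 ;
  pmf_sum1 : \esum_(x in [set: option nat]) (pmf x)%:E = 1%E }.

Definition geometric_pmf (R : realType) (q : R) (x : option nat) : R :=
  match x with
  | Some 0 => 0
  | Some k.+1 => (1 - q) ^+ k * q
  | None => (q == 0)%:R
  end.

(* Resources and requests are numbered from 0. *)
Record matching_instance (R : realType) := MatchingInstance {
  nres : nat ;
  nreq : nat ;
  nbr : 'I_nreq -> {set 'I_nres} ;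
  rew : 'I_nres -> R ;
  rew_ge0 : forall i, 0 <= rew i ;
  rew_mono : forall i j : 'I_nres, (i <= j)%N -> rew i <= rew j ;
  law : 'I_nres -> usage_law R }.

Section Policies.
Variables (R : realType) (I : matching_instance R).
Local Notation N := (nres I).
Local Notation T := (nreq I).

(* The record (t, I_t, A_t) of a past round; [None] stands for "no match". *)
Definition round : Type := ('I_T * {set 'I_N} * option 'I_N)%type.

(* [pi t h S] is the decision at time t after the past rounds h, when the set
   of available resources is S.  Realized durations are seen only through the
   availability sets. *)
Definition policy : Type := 'I_T -> seq round -> {set 'I_N} -> option 'I_N.

Definition admissible (pi : policy) : Prop :=
  forall t h S i, pi t h S = Some i -> i \in nbr t :&: S.

Definition greedy : policy := fun t _ S =>
  [pick i in nbr t :&: S | [forall j in nbr t :&: S, (j <= i)%N]].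

(* [d (i, t)] is the duration D_it of the match of i to t, should it occur. *)
Definition scenario : Type := {ffun 'I_N * 'I_T -> option nat}.

Definition returned (s : nat) (D : option nat) (t : nat) : bool :=
  if D is Some k then (s + k <= t)%N else false.

Definition available (d : scenario) (t : 'I_T) (h : seq round) : {set 'I_N} :=
  [set i | all (fun e : round =>
     (e.2 == Some i) ==> returned e.1.1 (d (i, e.1.1)) t) h]%SET.

Definition run (pi : policy) (d : scenario) : seq round :=
  foldl (fun h t => let S := available d t h in rcons h (t, S, pi t h S))
    [::] (enum 'I_T).

Definition total_reward (pi : policy) (d : scenario) : R :=
  \sum_(e <- run pi d) (if e.2 is Some i then rew i else 0).

(* Independence of the D_it: the joint law is the product law. *)
Definition scenario_prob (d : scenario) : R := \prod_x law x.1 (d x).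

(* The sum is finite, as total rewards are bounded, so [fine] is harmless. *)
Definition expected_reward (pi : policy) : R :=
  fine (\esum_(d in [set: scenario]) (scenario_prob d * total_reward pi d)%:E).

Definition Greedy : R := expected_reward greedy.

Definition OPT : R := sup [set expected_reward pi | pi in admissible].

End Policies.

(* Main.v *)
Require Import Defs.
From HB Require Import structures.
From mathcomp Require Import all_boot all_order all_algebra.
From mathcomp Require Import all_classical all_reals all_analysis.
Set Implicit Arguments.
Unset Strict Implicit.
Unset Printing Implicit Defensive.
Import Order.TTheory GRing.Theory Num.Theory.
Local Open Scope classical_set_scope.
Local Open Scope ring_scope.

(** Two resources of equal reward 1, both geometric with parameter [p], and two
    requests, the first adjacent to both resources and the second only to the
    higher one.  Matching along the diagonal serves both requests whatever the
    durations, whereas greedy spends the higher resource on the first request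
    and serves the second one only if that resource is back after one round,
    which has probability [p].  The ratio is exactly [(1 + p) / 2]. *)

(** * Unordered sums: scaling and independent coordinates *)

Lemma esumZl (R : realType) (T : choiceType) (A : set T) (f : T -> \bar R)
    (c : R) : 0 <= c -> (forall x, (0 <= f x)%E) ->
  \esum_(x in A) (c%:E * f x)%E = (c%:E * \esum_(x in A) f x)%E.
Proof.
(* One inequality suffices: for [0 < c] the reverse one is [scale_le] for the factor [c^-1] and the
   scaled family. *)
have scale_le (g : T -> \bar R) a : 0 <= a -> (forall x, (0 <= g x)%E) ->
    (\esum_(x in A) (a%:E * g x) <= a%:E * \esum_(x in A) g x)%E.
  move=> a0 g0; apply: ge_ereal_sup => _ [X XA] <-.
  rewrite -ge0_mule_fsumr// lee_wpmul2l ?lee_fin// esum_ge//.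
  by exists X.
rewrite le_eqVlt => /predU1P[<- _|c0 f0].
  by rewrite mul0e esum1// => x _; rewrite mul0e.
apply/eqP; rewrite eq_le scale_le ?(ltW c0)//= -lee_pdivlMl//.
rewrite [leLHS](_ : _ = \esum_(x in A) (c^-1%:E * (c%:E * f x)))%E.
  apply: scale_le => [|x]; rewrite ?invr_ge0 ?(ltW c0)//.
  by rewrite mule_ge0// lee_fin ltW.
by apply: eq_esum => x _; rewrite muleA -EFinM mulVf ?gt_eqF// mul1e.
Qed.

(** Fubini for finitely many independent coordinates, peeled off one at a time; [y0] pins the
    coordinates not yet summed over. *)
Lemma esum_prod_ffun (R : realType) (X : finType) (Y : choiceType) (y0 : Y)
    (f : X -> Y -> R) (c : X -> R) :
    (forall x y, 0 <= f x y) ->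
    (forall x, \esum_(y in [set: Y]) (f x y)%:E = (c x)%:E) ->
  \esum_(d in [set: {ffun X -> Y}]) (\prod_x f x (d x))%:E = (\prod_x c x)%:E.
Proof.
move=> f0 fc.
have c0 x : 0 <= c x by rewrite -lee_fin -fc esum_ge0// => y _; rewrite lee_fin.
pose D (s : seq X) := [set d : {ffun X -> Y} | forall x, x \notin s -> d x = y0].
(* Induction on [s]: [D s] grows from one constant function to all functions. *)
suff partial s : uniq s ->
    \esum_(d in D s) (\prod_(x <- s) f x (d x))%:E = (\prod_(x <- s) c x)%:E.
  rewrite -(partial _ (index_enum_uniq X)); congr esum.
  by apply/seteqP; split=> d //= _ x; rewrite mem_index_enum.
elim: s => [_|x s IHs /= /andP[xs us]].
  rewrite (_ : D [::] = [set [ffun=> y0]]).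
    by rewrite esum_set1 !big_nil// lee_fin.
  apply/seteqP; split=> [d d0|_ -> x _]; last by rewrite ffunE.
  by apply/ffunP => x; rewrite ffunE d0.
(* A bijection from pairs onto [D (x :: s)]; it is injective because members of [D s] equal [y0] at
   [x]. *)
pose upd (k : Y * {ffun X -> Y}) := [ffun z => if z == x then k.1 else k.2 z].
rewrite (@reindex_esum _ _ _ ([set: Y] `*`` fun=> D s) _ upd); last first.
  split=> [[y d] /= [_ dD] z| [y d] [y' d'] |d dD].
  - by rewrite inE negb_or => /andP[/negPf zx /dD]; rewrite ffunE zx.
  - rewrite !inE/= => -[_ dD] [_ dD'] /ffunP e; congr pair.
      by have := e x; rewrite !ffunE eqxx.
    apply/ffunP => z; have := e z; rewrite !ffunE; case: eqP => // -> _.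
    by rewrite dD// dD'.
  exists (d x, [ffun z => if z == x then y0 else d z]) => /=.
    split=> // z zs; rewrite ffunE; case: eqVneq => // zx.
    by rewrite dD// inE negb_or zx.
  by apply/ffunP => z; rewrite !ffunE; case: eqP => // ->.
transitivity (\esum_(y in [set: Y]) \esum_(d in D s)
    ((\prod_(z <- s) f z (d z))%:E * (f x y)%:E)%E).
  rewrite esum_esum; last first.
    by move=> *; rewrite -EFinM lee_fin mulr_ge0// prodr_ge0.
  apply: eq_esum => -[y d] _ /=; rewrite big_cons ffunE eqxx EFinM muleC.
  congr (_%:E * _)%E; apply: eq_big_seq => z zs; rewrite ffunE.
  by case: eqP zs xs => // -> ->.
rewrite big_cons EFinM -fc muleC -esumZl; first last.
- by move=> *; rewrite lee_fin.
- exact: prodr_ge0.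
apply: eq_esum => y _; rewrite -(IHs us) muleC -esumZl//; last first.
  by move=> *; rewrite lee_fin prodr_ge0.
by apply: eq_esum => d _; rewrite muleC.
Qed.

(** * The geometric distribution as a usage law *)

Section GeometricLaw.
Variables (R : realType) (p : R).
Hypothesis p01 : 0 <= p <= 1.

Lemma geometric_pmf_ge0 x : 0 <= geometric_pmf p x.
Proof.
have /andP[p0 p1] := p01.
by case: x => [[|k]|] //=; rewrite mulr_ge0// exprn_ge0// subr_ge0.
Qed.

Lemma geometric_pmf_sum1 :
  \esum_(x in [set: option nat]) (geometric_pmf p x)%:E = 1%E.
Proof.
have /andP[p0 p1] := p01.
have pmf0 x : (0 <= (geometric_pmf p x)%:E)%E.
  by rewrite lee_fin geometric_pmf_ge0.
have [p_eq0|pN0] := eqVneq p 0.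
  rewrite (esumID [set None])// setTI esum_set1//= [X in (_ + X)%E]esum1.
    by rewrite p_eq0 eqxx adde0.
  by move=> [[|k]|] [_]//= _; rewrite p_eq0 mulr0.
(* For nonzero [p] all mass lies on the range of [pos], where the sum is a geometric series of ratio
   [1 - p] and value [p / p]. *)
pose pos (k : nat) := Some k.+1.
rewrite (esumID (range pos))//.
rewrite [X in (_ + X)%E]esum1 ?adde0; last first.
  move=> [[|k]|] [_]//=; last by rewrite (negPf pN0).
  by case; exists k.
rewrite setTI esum_image; last by move=> k k' _ _ [].
rewrite -nneseries_esumT//; apply: cvg_lim => //=.
have -> : (fun n => \sum_(0 <= i < n) ((1 - p) ^+ i * p)%:E)%E =
    EFin \o series (geometric p (1 - p)).
  apply/funext => n /=; rewrite /series/= -sumEFin.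
  by apply: eq_bigr => i _; rewrite mulrC.
apply/fine_cvgP; split; first exact: nearW.
have := @cvg_geometric_series R p (1 - p).
rewrite subKr divff//; apply.
by rewrite ger0_norm ?subr_ge0// gtrBl lt_def pN0.
Qed.

Definition geometric_law : usage_law R :=
  @UsageLaw R (geometric_pmf p) geometric_pmf_ge0 erefl geometric_pmf_sum1.

End GeometricLaw.

(** * Computing and bounding expected rewards *)

Section ExpectedReward.
Variables (R : realType) (I : matching_instance R).
Local Notation N := (nres I).
Local Notation T := (nreq I).

Lemma scenario_prob_ge0 (d : scenario I) : 0 <= scenario_prob d.
Proof. by rewrite prodr_ge0// => x _; exact: Defs.pmf_ge0. Qed.

Lemma scenario_prob_sum1 :
  \esum_(d in [set: scenario I]) (scenario_prob d)%:E = 1%E.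
Proof.
rewrite (@esum_prod_ffun R _ _ None (fun x => law x.1) (fun=> 1)).
- by rewrite big1.
- by move=> *; exact: Defs.pmf_ge0.
- by move=> x; exact: pmf_sum1.
Qed.

Lemma total_reward_ge0 (pi : policy I) (d : scenario I) :
  0 <= total_reward pi d.
Proof. by rewrite sumr_ge0// => -[[? ?] [i|]] _ //=; exact: rew_ge0. Qed.

Lemma expected_reward_cst (pi : policy I) (c : R) :
  (forall d, total_reward pi d = c) -> expected_reward pi = c.
Proof.
move=> pic.
have c0 : 0 <= c by rewrite -(pic [ffun=> None]) total_reward_ge0.
rewrite /expected_reward.
under eq_esum do rewrite pic mulrC EFinM.
rewrite esumZl//; last by move=> d; rewrite lee_fin scenario_prob_ge0.
by rewrite scenario_prob_sum1 mule1.
Qed.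

Lemma expected_reward_le (pi : policy I) (c : R) :
  (forall d, total_reward pi d <= c) -> expected_reward pi <= c.
Proof.
move=> pic; rewrite -[leRHS]/(fine c%:E).
have c0 : 0 <= c.
  exact: le_trans (total_reward_ge0 pi _) (pic [ffun=> None]).
(* This bound also makes the sum finite, so that [fine] preserves the inequality. *)
suff le_c : (\esum_(d in [set: scenario I])
    (scenario_prob d * total_reward pi d)%:E <= c%:E)%E.
  rewrite fine_le// ge0_fin_numE ?(le_lt_trans le_c) ?ltry// esum_ge0// => d _.
  by rewrite lee_fin mulr_ge0 ?scenario_prob_ge0 ?total_reward_ge0.
rewrite -[leRHS]mule1 -scenario_prob_sum1 -esumZl//; last first.
  by move=> d; rewrite lee_fin scenario_prob_ge0.
apply: le_esum => d _.
by rewrite -EFinM lee_fin mulrC ler_wpM2r ?scenario_prob_ge0.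
Qed.

(** When the reward depends on a single duration, all the other durations sum out to 1. *)
Lemma expected_reward_marginal (pi : policy I) (z : 'I_N * 'I_T)
    (g : option nat -> R) (c : R) :
  (forall d, total_reward pi d = g (d z)) -> (forall y, 0 <= g y) ->
  \esum_(y in [set: option nat]) (law z.1 y * g y)%:E = c%:E ->
  expected_reward pi = c.
Proof.
move=> pig g0 gc; rewrite /expected_reward.
(* Absorbing the reward into the factor at [z] keeps the summand a product over coordinates. *)
pose f (x : 'I_N * 'I_T) y := law x.1 y * (if x == z then g y else 1).
rewrite (_ : esum _ _ = \esum_(d in [set: scenario I]) (\prod_x f x (d x))%:E).
  rewrite (@esum_prod_ffun R _ _ None f (fun x => if x == z then c else 1)).
  - by rewrite -big_mkcond/= big_pred1_eq.
  - move=> x y; rewrite mulr_ge0 ?Defs.pmf_ge0//; by case: ifP.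
  - move=> x; rewrite /f; case: eqVneq => [-> //|_].
    by under eq_esum do rewrite mulr1; exact: pmf_sum1.
apply: eq_esum => d _; rewrite big_split/= -big_mkcond/= big_pred1_eq.
by rewrite pig.
Qed.

End ExpectedReward.

(** * The two-resource instance *)

Section TwoResources.
Variables (R : realType) (p : R).
Hypothesis p01 : 0 <= p <= 1.

Definition two_resources : matching_instance R :=
  @MatchingInstance R 2 2 (fun t => [set i : 'I_2 | (t <= i)%N]%SET) (fun=> 1)
    (fun=> ler01) (fun _ _ _ => lexx 1) (fun=> geometric_law p01).

Local Notation I := two_resources.
Local Notation i0 := (@Ordinal 2 0 isT).
Local Notation i1 := (@Ordinal 2 1 isT).

Lemma enum_I2 : enum 'I_2 = [:: i0; i1].
Proof. by apply: (inj_map val_inj); rewrite val_enum_ord. Qed.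

Definition diagonal_policy : policy I :=
  fun t _ S => if t \in S then Some t else None.

Lemma diagonal_admissible : admissible diagonal_policy.
Proof.
move=> t h S i; rewrite /diagonal_policy; case: ifP => // tS [<-].
by rewrite !inE leqnn.
Qed.

(** Rewards are 1, so the total counts the matches made in the two rounds. *)
Lemma total_reward_two (pi : policy I) (d : scenario I) :
  let S0 := available d i0 [::] in
  let h := [:: (i0, S0, pi i0 [::] S0)] in
  total_reward pi d =
    (pi i0 [::] S0 != None)%:R + (pi i1 h (available d i1 h) != None)%:R.
Proof.
rewrite /total_reward /run enum_I2 /= !big_cons big_nil addr0.
by congr (_ + _) => /=; case: (pi _ _ _).
Qed.

Lemma total_reward_diagonal (d : scenario I) :
  total_reward diagonal_policy d = 2.
Proof. by rewrite total_reward_two /diagonal_policy !inE. Qed.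

Lemma OPT_two : OPT I = 2.
Proof.
(* Each of the two requests yields at most 1 in every scenario. *)
have ub : ubound [set expected_reward pi | pi in @admissible _ I] 2.
  move=> _ [pi _ <-]; apply: expected_reward_le => d.
  by rewrite total_reward_two -natrD ler_nat; do 2 case: (_ != None).
apply/eqP; rewrite eq_le; apply/andP; split.
  by apply: ge_sup => //; exists (expected_reward diagonal_policy);
    exists diagonal_policy => //; exact: diagonal_admissible.
apply: ub_le_sup; first by exists 2.
exists diagonal_policy; first exact: diagonal_admissible.
exact/expected_reward_cst/total_reward_diagonal.
Qed.

Lemma total_reward_greedy (d : scenario I) :
  total_reward (@greedy R I) d = 1 + (returned 0 (d (i1, i0)) 1)%:R.
Proof.
(* Closed form of the rule: [i1] is adjacent to both requests and wins whenever available, while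
   [i0] can only serve request [i0]. *)
have greedy1 (t : 'I_2) h (S : {set 'I_2}) : greedy (I := I) t h S =
    if i1 \in S then Some i1 else if (t == i0) && (i0 \in S) then Some i0 else None.
  have I2P (i : 'I_2) : i = i0 \/ i = i1.
    by case: i => [[|[|//]] ?]; [left|right]; exact: val_inj.
  have t_le1 : (t <= i1)%N by rewrite -ltnS.
  rewrite /greedy; case: pickP => [i /andP[]|none].
    rewrite !inE => /andP[ti iS] /forallP/(_ i1); rewrite !inE t_le1.
    case: (I2P i) ti iS => -> ti iS; last by rewrite iS.
    have -> : t = i0 by apply/val_inj/eqP; rewrite -leqn0.
    by rewrite iS; case: ifP.
  case: ifPn => i1S.
    have := none i1; rewrite !inE t_le1 i1S => /negP[].
    by apply/forallP => j; rewrite -ltnS ltn_ord implybT.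
  case: ifP => // /andP[/eqP t0 i0S].
  have := none i0; rewrite !inE t0 i0S => /negP[].
  apply/forallP => j; rewrite !inE.
  by case: (I2P j) => ->; rewrite ?(negPf i1S) ?implybT.
rewrite total_reward_two !greedy1 !inE /= andbT.
by case: returned.
Qed.

Lemma Greedy_two : Greedy I = 1 + p.
Proof.
rewrite /Greedy; apply: (@expected_reward_marginal _ I _ (i1, i0)
  (fun y => 1 + (returned 0 y 1)%:R) _ total_reward_greedy) => [y|/=].
  by rewrite addr_ge0.
under eq_esum do rewrite mulrDr mulr1 EFinD.
have pmf0 y := geometric_pmf_ge0 p01 y.
rewrite esumD; last first.
- by move=> y _; rewrite lee_fin mulr_ge0.
- by move=> y _; rewrite lee_fin.
(* Only [Some 1] contributes to the return probability, with mass [p]: [Some 0] passes the test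
   [returned] but has no mass, and longer durations fail it. *)
rewrite (geometric_pmf_sum1 p01) EFinD (esumID [set Some 1%N]); last first.
  by move=> y _; rewrite lee_fin mulr_ge0.
rewrite setTI esum_set1/= ?mulr1 ?mul1r ?expr0 ?mul1r; last first.
  by have /andP[] := p01.
rewrite esum1 ?adde0//.
by move=> [[|[|k]]|] [_]//= _; rewrite ?mul0r ?mulr0.
Qed.

End TwoResources.

Theorem mainTheorem3 (R : realType) (p eps : R) (hp : 0 <= p <= 1)
    (heps : 0 < eps) :
  exists (I : matching_instance R) (q : 'I_(nres I) -> R),
    [/\ forall i, 0 <= q i <= 1,
        forall i, law i =1 geometric_pmf (q i),
        (exists i, q i = p) /\ (forall i, p <= q i),
        0 < OPT I
      & Greedy I / OPT I <= (1 + p) / 2 + eps].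
Proof.
exists (two_resources hp), (fun=> p).
(* With both values known, the ratio bound reduces to [0 <= eps]. *)
rewrite OPT_two Greedy_two lerDl (ltW heps).
by split=> //; split=> //; exists (@ord0 1).
Qed.
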